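(* For every integer $t$, there is a function $f_t: \mathbb{N} \to \mathbb{N}$ such that for every digraph $D$ which is $t$-chordal and has no induced directed path with exactly $t$ vertices, we have $\vec{\chi}(D) \le f_t(\omega(D))$.
   Context: All digraphs are finite and simple: no loops, no parallel edges, and for two vertices $u,v$ not both of $uv$ and $vu$ are edges. A digraph is acyclic if it has no directed cycle. A $k$-dicoloring of a digraph $D$ is a function $f: V(D) \to \{1,\dots,k\}$ such that each color class $f^{-1}(i)$ induces an acyclic subdigraph. The dichromatic number $\vec{\chi}(D)$ is the minimum $k$ for which a $k$-dicoloring exists. $\omega(D)$ is the clique number of the underlying undirected graph of $D$. A digraph is $t$-chordal if every induced directed cycle in it has length exactly $t$. An induced directed path is a directed path $v_1 \to v_2 \to \dots \to v_m$ whose vertex set induces exactly the edges $v_iv_{i+1}$, $1 \le i < m$. *)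

(* Defs.v *)
From mathcomp Require Import all_boot all_order all_algebra.

Set Implicit Arguments.
Unset Strict Implicit.
Unset Printing Implicit Defensive.

Record digraph := Digraph {
  vertex :> finType;
  edge : rel vertex;
  edge_irrefl : irreflexive edge;
  edge_asym : forall u v : vertex, ~~ (edge u v && edge v u)
}.
Arguments edge {d}.

Section Digraph.
Variable D : digraph.
Implicit Types (A K : {set D}) (s : seq D).

(* The vertex s`_i is followed by s`_(i+1), and the last one by the first.
   Since D has no loops and no 2-cycles, such an s has at least 3 vertices. *)
Definition dicycle s : bool := [&& s != [::], uniq s & cycle edge s].

Definition induced_dicycle s : Prop :=
  dicycle s /\ {in s &, forall u v, edge u v -> v = next s u}.

Definition dipath s : bool := [&& s != [::], uniq s & sorted edge s].

Definition induced_dipath s : Prop :=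
  dipath s /\ {in s &, forall u v, edge u v -> index v s = (index u s).+1}.

(* A directed cycle visits no vertex twice, so it suffices to range over
   sequences of at most #|D| vertices, which makes acyclicity a boolean;
   acyclicP removes the bound. *)
Definition acyclic A : bool :=
  [forall n : 'I_#|D|.+1, forall s : n.-tuple D,
     (all (mem A) s) ==> ~~ dicycle s].

Lemma acyclicP A :
  reflect (forall s, {subset s <= A} -> ~~ dicycle s) (acyclic A).
Proof.
apply: (iffP forallP) => [acA s sA | acA n].
  apply/negP => cs; have [_ us _] := and3P cs.
  have ltsD : size s < #|D|.+1 by rewrite ltnS -(card_uniqP us) max_card.
  move/forallP/(_ (in_tuple s)): (acA (Ordinal ltsD)) => /implyP/(_ _)/negP.
  by apply=> //; apply/allP.
by apply/forallP => s; apply/implyP => /allP; apply: acA.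
Qed.

Definition dicoloring k (f : {ffun D -> 'I_k}) : bool :=
  [forall i : 'I_k, acyclic [set v | f v == i]].

Definition dicolorable k : bool := [exists f : {ffun D -> 'I_k}, dicoloring f].

Lemma dicolorable_ex : exists k, dicolorable k.
Proof.
exists #|D|; apply/existsP; exists [ffun v => enum_rank v].
apply/forallP => i; apply/acyclicP => -[//|x [|y s]] sA.
  by rewrite /dicycle /= edge_irrefl.
have: x \in [set v | [ffun w => enum_rank w] v == i].
  by apply: sA; rewrite !inE eqxx.
have: y \in [set v | [ffun w => enum_rank w] v == i].
  by apply: sA; rewrite !inE eqxx orbT.
rewrite !inE !ffunE => /eqP <- /eqP /enum_rank_inj ->.
by rewrite /dicycle /= mem_head.
Qed.

Definition dichromatic_number : nat := ex_minn dicolorable_ex.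

Definition clique K : bool :=
  [forall u in K, forall v in K, (u != v) ==> (edge u v || edge v u)].

Definition clique_number : nat := \max_(K : {set D} | clique K) #|K|.

Definition chordal (t : int) : Prop :=
  forall s, induced_dicycle s -> (size s)%:Z%R = t.

Definition induced_dipath_free (t : int) : Prop :=
  forall s, induced_dipath s -> (size s)%:Z%R <> t.

End Digraph.

(* Main.v *)
(* Induct on the clique number; a digraph D may be assumed strong, and out- and
   in-neighbourhoods have bounded dichromatic number.  In a t-chordal digraph
   without induced directed t-vertex path, a t-vertex path without forward chords
   must have an edge from its last to its first vertex: a shortest backward chord
   spans an induced directed cycle, which therefore uses the whole path.  Hence
   if C is strong with large dichromatic number and x is at distance 1 or 2 to C,
   then x has an in-neighbour in C: otherwise a path from x through C, built in
   the manner of Gyarfas, reaches t vertices without a closing edge.  This applies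
   to the converse of D as well, so a vertex at distance exactly 2 to C would have
   an in-neighbour in C, hence also an out-neighbour, a contradiction.  But if the
   dichromatic number of D is large, then some such C avoids a vertex v and all
   its neighbours, and a vertex at distance 2 to C exists since D is strong.  For
   t <= 2 there is no directed cycle at all, a shortest one being induced. *)
Require Import Defs.
From mathcomp Require Import all_boot all_order all_algebra.
From mathcomp Require Import zify.

Set Implicit Arguments.
Unset Strict Implicit.
Unset Printing Implicit Defensive.

(** * Colorings with acyclic classes and the reduction to strong sets *)

Section Coloring.
Variable D : digraph.
Implicit Types (A B C R : {set D}) (k n : nat).

(** Colors are plain naturals and [f] is total, so that colorings of different sets combine freely;
    only values on [A] matter. *)
Definition colorable k A : Prop :=
  exists f : D -> nat, {in A, forall v, f v < k} /\
    forall i, acyclic [set v in A | f v == i].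

(* Connectivity is expressed by cuts instead of paths: a set without an exit is
   closed under out-neighbours, and complementation makes [strong] self-converse. *)
Definition exits R B : bool := [exists x in B, exists y in R :\: B, edge x y].

Definition strong C : bool :=
  [forall B : {set D}, [&& B \subset C, B != set0 & B != C] ==> exits C B].

(** Cut form of: each vertex of [R] has a directed path within [R] that ends in [C]. *)
Definition reaches R C : bool :=
  [forall B : {set D},
     [&& B \subset R, B != set0 & [disjoint B & C]] ==> exits R B].

Lemma exitsP R B :
  reflect (exists x y, [/\ x \in B, y \in R, y \notin B & edge x y]) (exits R B).
Proof.
apply: (iffP exists_inP) => [[x xB /exists_inP[y]]|[x [y [xB yR yB xy]]]].
  by rewrite inE => /andP[yB yR] xy; exists x, y.
by exists x => //; apply/exists_inP; exists y; rewrite // inE yB.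
Qed.

Lemma strongP C :
  reflect (forall B, B \subset C -> B != set0 -> B != C -> exits C B) (strong C).
Proof.
apply: (iffP forallP) => [sC B sB B0 BC | sC B].
  by have /implyP-> := sC B; rewrite ?sB ?B0.
by apply/implyP => /and3P[]; apply: sC.
Qed.

Lemma reachesP R C :
  reflect (forall B, B \subset R -> B != set0 -> [disjoint B & C] -> exits R B)
          (reaches R C).
Proof.
apply: (iffP forallP) => [rC B sB B0 BC | rC B].
  by have /implyP-> := rC B; rewrite ?sB ?B0.
by apply/implyP => /and3P[]; apply: rC.
Qed.

Lemma reaches_refl C : reaches C C.
Proof.
apply/reachesP => B BC /negP B0 dBC; case: B0.
by rewrite -(setIidPl BC) setI_eq0.
Qed.

Lemma acyclic_sub A B : A \subset B -> acyclic B -> acyclic A.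
Proof.
move=> /subsetP sAB /acyclicP acB; apply/acyclicP => s sA.
by apply: acB => x /sA /sAB.
Qed.

(** No edge of [A] leaves [B], so a directed cycle in [A] that meets [B] stays in [B]. *)
Lemma acyclic_closed A B : acyclic (A :&: B) -> acyclic (A :\: B) ->
  {in A :&: B & A, forall x y, edge x y -> y \in B} -> acyclic A.
Proof.
move=> /acyclicP acI /acyclicP acD clB; apply/acyclicP => s sA.
have [hB|/hasPn nB] := boolP (has (mem B) s); last first.
  by apply: acD => x xs; rewrite inE (nB x xs) sA.
apply/negP => cs; have [_ us cyc] := and3P cs.
have [x xs xB] := hasP hB; have [i p Es] := rot_to xs.
have pB : path edge x (rcons p x) by move: cyc; rewrite -(rot_cycle i) Es.
have sA' y : y \in x :: p -> y \in A by rewrite -Es mem_rot; apply: sA.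
apply/negP: cs; apply: acI => y ys; rewrite inE sA //=.
have: y \in x :: p by rewrite -Es mem_rot.
rewrite inE => /predU1P[->//|yp].
have {ys yp}: y \in rcons p x by rewrite mem_rcons inE yp orbT.
have sA2 z : z \in rcons p x -> z \in A by rewrite mem_rcons; apply: sA'.
move: (sA x xs) (xB : x \in B) pB sA2; move: (rcons p x) => q.
elim: q x {xs xB Es sA'} => // z q IH x xA xB /= /andP[xz pq] sA2.
have zA : z \in A by apply: sA2; rewrite mem_head.
have zB : z \in B by apply: clB xz; rewrite ?inE ?xA ?xB.
rewrite inE => /predU1P[->//|]; apply: IH zA zB pq _.
by move=> u uq; apply: sA2; rewrite inE uq orbT.
Qed.

Lemma colorableW k l A B : k <= l -> A \subset B -> colorable k B -> colorable l A.
Proof.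
move=> kl sAB [f [fk acf]]; exists f; split=> [v /(subsetP sAB)/fk|i].
  by move=> /leq_trans; apply.
apply: acyclic_sub (acf i); apply/subsetP => v; rewrite !inE => /andP[/(subsetP sAB)->].
by [].
Qed.

(** No directed cycle crosses between the two sides, so both can use the same [k] colors. *)
Lemma colorable_closed k A B : colorable k (A :&: B) -> colorable k (A :\: B) ->
  {in A :&: B & A, forall x y, edge x y -> y \in B} -> colorable k A.
Proof.
move=> [f [fk acf]] [g [gk acg]] clB.
exists (fun v => if v \in B then f v else g v); split=> [v vA|i].
  by case: ifPn => vB; [apply: fk | apply: gk]; rewrite !inE ?vB ?vA.
apply: (@acyclic_closed _ B).
- apply: acyclic_sub (acf i); apply/subsetP => v; rewrite !inE.
  by case: (v \in B); rewrite ?andbF // !andbT.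
- apply: acyclic_sub (acg i); apply/subsetP => v; rewrite !inE.
  by case: (v \in B).
move=> x y; rewrite !inE -!andbA => /and3P[xA _ xB] /andP[yA _].
by apply: clB; rewrite ?inE ?xA.
Qed.

Lemma colorableU k l A B : colorable k A -> colorable l B -> colorable (k + l) (A :|: B).
Proof.
move=> [f [fk acf]] [g [gl acg]].
exists (fun v => if v \in A then f v else k + g v); split=> [v|i].
  rewrite inE; case: ifPn => [vA _|vA /= vB]; first exact/ltn_addr/fk.
  by rewrite ltn_add2l gl.
have [ik|ki] := ltnP i k.
  apply: acyclic_sub (acf i); apply/subsetP => v; rewrite !inE.
  case: (v \in A) => [//|/= /andP[_ /eqP Ei]].
  by move: ik; rewrite -Ei ltnNge leq_addr.
apply: acyclic_sub (acg (i - k)); apply/subsetP => v; rewrite !inE.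
case vA: (v \in A) => /=; last by case/andP=> -> /eqP <-; rewrite addKn eqxx.
by move=> /eqP Ei; have := fk v vA; rewrite Ei ltnNge ki.
Qed.

Lemma colorable0 k : colorable k set0.
Proof.
exists (fun=> 0); split=> [v|i]; first by rewrite inE.
by apply/acyclicP => -[|x s] // /(_ x (mem_head _ _)); rewrite !inE.
Qed.

Lemma colorable1 v : colorable 1 [set v].
Proof.
exists (fun=> 0); split=> // i; apply/acyclicP => s sv; apply/negP => /and3P[].
case: s sv => // x [|y s] sv _; first by rewrite /= edge_irrefl.
have /[!inE] /andP[/eqP-> _] := sv x (mem_head _ _).
have: y \in [:: x, y & s] by rewrite !inE eqxx orbT.
by move=> /sv /[!inE] /andP[/eqP-> _] /andP[]; rewrite inE eqxx.
Qed.

(** A set that is not strong has a proper nonempty part without exit; [colorable_closed] glues the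
    two sides, by induction on cardinality. *)
Lemma strong_colorable k A :
  (forall C, C \subset A -> strong C -> colorable k C) -> colorable k A.
Proof.
have [n] := ubnP #|A|; elim: n A => // n IH A; rewrite ltnS => leAn colA.
have [sA|/forallPn[B]] := boolP (strong A); first exact: colA.
rewrite negb_imply => /andP[/and3P[sBA B0 BA] nB].
have IHs B' : B' \proper A -> colorable k B'.
  move=> pB; apply: IH; first exact: leq_trans (proper_card pB) leAn.
  by move=> C sC; apply/colA/(subset_trans sC)/proper_sub.
apply: (@colorable_closed _ _ B).
- by rewrite (setIidPr sBA); apply: IHs; rewrite properEneq BA.
- apply: IHs; rewrite properEneq subsetDl andbT; apply: contra B0 => /eqP E.
  by rewrite -(setIidPr sBA) -{1}E setIDAC setDIl setDv setI0.
move=> x y; rewrite inE => /andP[_ xB] yA xy; apply: contraNT nB => yB.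
by apply/exitsP; exists x, y.
Qed.

End Coloring.

(** * Paths without forward chords and their growth *)

Section ForwardPaths.
Variable D : digraph.
Implicit Types (C R A : {set D}) (s : seq D).

(** Backward edges remain unrestricted. *)
Definition forward_dipath s : Prop :=
  uniq s /\ forall x0 i j, i < j < size s ->
    edge (nth x0 s i) (nth x0 s j) = (j == i.+1).

Definition closing t : Prop :=
  forall x0 s, size s = t -> forward_dipath s ->
    edge (nth x0 s t.-1) (nth x0 s 0).

Lemma nth_next (x0 : D) s i : uniq s -> i < size s ->
  next s (nth x0 s i) = nth x0 s (if i.+1 < size s then i.+1 else 0).
Proof.
move=> us lt_i; rewrite next_nth mem_nth // index_uniq //.
case: s us lt_i => // y p _ /=; rewrite !ltnS => le_ip.
case: ltnP => [lt_ip|ge_ip]; first exact: set_nth_default.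
by rewrite nth_default.
Qed.

Lemma chordal_closing t : 0 < t -> chordal D t%:Z%R ->
  induced_dipath_free D t%:Z%R -> closing t.
Proof.
move=> t0 chD pfD x0 s szs [us fs].
(* [P m]: some edge goes back along [s] by exactly [m] positions. *)
pose P m := [exists i : 'I_t, [&& 0 < m, i + m < t &
  edge (nth x0 s (i + m)) (nth x0 s i)]].
have PI i j : i < j < t -> edge (nth x0 s j) (nth x0 s i) -> P (j - i).
  move=> /andP[ij jt] e; apply/existsP; exists (Ordinal (ltn_trans ij jt)).
  by rewrite /= subn_gt0 ij subnKC ?jt // ltnW.
have irr := @edge_irrefl D.
have [/'exists_existsP exP|] := boolP [exists m : 'I_t, P m].
  have {}exP : exists m, P m by case: exP => m [i Pi]; exists m; apply/existsP; exists i.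
  case: (ex_minnP exP) => m /existsP[[i /= it] /and3P[m0 imt e]] minm.
  (* By minimality of [m], the only backward edge within this segment joins its ends, so it is an
     induced directed cycle. *)
  pose c := take m.+1 (drop i s).
  have szc : size c = m.+1.
    by rewrite size_take size_drop szs; case: ltnP => //; lia.
  have nthc k : k <= m -> nth x0 c k = nth x0 s (i + k).
    by move=> km; rewrite nth_take // nth_drop.
  have uc : uniq c by rewrite take_uniq // drop_uniq.
  have nextc k : k <= m -> next c (nth x0 c k) = nth x0 s (if k < m then i + k.+1 else i).
    move=> km; rewrite nth_next ?szc // !ltnS.
    by case: ltnP => [lt|ge]; rewrite nthc ?addn0.
  have ind : induced_dicycle c.
    split; first apply/and3P; first split.
    - by rewrite -size_eq0 szc.
    - exact: uc.
    - apply: (cycle_from_next uc) => x /(nthP x0)[k]; rewrite szc ltnS => km <-.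
      rewrite nextc // nthc //; case: ltnP => km'.
        by rewrite fs ?addnS ?eqxx // szs; lia.
      by rewrite (_ : k = m) //; lia.
    move=> u v /(nthP x0)[a]; rewrite szc ltnS => am <- /(nthP x0)[b].
    rewrite szc ltnS => bm <-; rewrite nextc // !nthc //.
    have [ab|ba|->] := ltngtP a b; last by rewrite irr.
      rewrite fs; last by rewrite szs; lia.
      by move=> /eqP ->; rewrite ifT ?addnS //; lia.
    move=> e'; have := PI (i + b) (i + a); rewrite e' => /(_ _ isT)/minm h.
    have {}h : m <= a - b by rewrite -(subnDl i); apply: h; lia.
    by rewrite ifF; [rewrite (_ : b = 0) ?addn0 //; lia|apply/negbTE; lia].
  have [szt] : (m.+1%:Z = t%:Z)%R by rewrite -szc; apply: chD.
  have i0 : i = 0 by lia.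
  by rewrite i0 add0n -szt in e *.
(* Without backward edges [s] is itself an induced path on [t] vertices. *)
move=> /existsPn noP; case: (pfD s); last by rewrite szs.
split.
  apply/and3P; split => //; first by rewrite -size_eq0 szs -lt0n.
  by apply/(sortedP x0) => i lti; rewrite fs ?eqxx // ltnS leqnn.
move=> u v /(nthP x0)[a + <-] /(nthP x0)[b + <-]; rewrite szs => at' bt.
have [ab|ba|->] := ltngtP a b; last by rewrite irr.
  by rewrite fs ?ab ?szs // => /eqP->; rewrite !index_uniq ?szs //; lia.
have lt : a - b < t by lia.
by move=> /PI; rewrite ba at' => /(_ isT) h; have := noP (Ordinal lt); rewrite /= h.
Qed.

Lemma forward_dipath1 (x : D) : forward_dipath [:: x].
Proof. by split=> // x0 i j; rewrite /=; lia. Qed.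

Lemma forward_dipath_rcons p (z w : D) :
  forward_dipath (rcons p z) -> w \notin rcons p z ->
  {in p, forall u, ~~ edge u w} -> edge z w ->
  forward_dipath (rcons (rcons p z) w).
Proof.
move=> [us fs] ws pw zw; split; first by rewrite rcons_uniq ws.
move=> x0 i j; rewrite size_rcons ltnS => /andP[ij].
rewrite leq_eqVlt => /predU1P[Ej|js]; last first.
  by rewrite !(nth_rcons _ (rcons _ _)) js (ltn_trans ij js) fs ?ij.
rewrite Ej in ij *; rewrite (nth_rcons _ (rcons p z) _ i) ij.
rewrite (nth_rcons _ (rcons p z)) ltnn eqxx; move: ij; rewrite size_rcons eqSS nth_rcons ltnS.
by case: ltngtP => // ip _; apply/negbTE/pw/mem_nth.
Qed.

(* The path [rcons p z] can leave its set of vertices towards R only through z,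
   and it is prolonged inside R, one vertex at a time, until it has t vertices;
   the closing edge then enters its first vertex from R.  The set C is the part
   of R that still has to be reached; each step removes from it the
   out-neighbourhood of z, which costs c colors. *)
Lemma no_in_neighbor_colorable t c n A R C p (z : D) :
  closing t -> {in A, forall v, colorable c [set u in A | edge v u]} ->
  (size p + n).+2 = t -> forward_dipath (rcons p z) ->
  {subset rcons p z <= A} -> R \subset A -> {in R, forall w, w \notin rcons p z} ->
  C \subset R -> reaches R C -> strong C ->
  {in p & R, forall u w, ~~ edge u w} -> (exists2 w, w \in R & edge z w) ->
  {in R, forall w, ~~ edge w (head z p)} ->
  colorable (n * c) C.
Proof.
move=> clt colA; elim: n R C p z => [|n IH] R C p z szp fs sA RA sR CR rRC stC noR.
  (* For [n = 0], appending [w] completes [t] vertices, and the closing edge from [w] contradicts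
     the last hypothesis. *)
  move=> [w wR zw] /(_ w wR)/negP[].
  have := clt z (rcons (rcons p z) w); rewrite !size_rcons -szp addn0 => /(_ erefl).
  move=> /(_ (forward_dipath_rcons fs (sR w wR) (fun u up => noR u w up wR) zw)).
  rewrite /= (nth_rcons _ (rcons _ _)) size_rcons ltnn eqxx.
  by case: (p) => [|? ?] /=.
move=> [w wR zw] noin; pose N := [set u in A | edge z u].
have zA : z \in A by rewrite sA // mem_rcons mem_head.
rewrite -(setID C N) mulSn; apply: colorableU.
  by apply: colorableW (colA z zA); rewrite ?subsetIr.
apply: strong_colorable => C' sC' stC'.
have [->|C'0] := eqVneq C' set0; first exact: colorable0.
have sC'C : C' \subset C := subset_trans sC' (subsetDl _ _).
have C'Q : C' \subset R :\: N := subset_trans sC' (setSD _ CR).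
have rRC' : reaches R C'.
  apply/reachesP => B BR B0 BC'.
  (* If [B] meets [C], it misses the nonempty [C'], hence part of [C], and strength of [C] gives the
     exit. *)
  have [BC|] := boolP [disjoint B & C]; first by apply: (reachesP _ _ rRC).
  rewrite -setI_eq0 => BC0.
  have BCC : B :&: C != C.
    apply: contra C'0 => /eqP/setIidPr CB; move: BC'; rewrite -setI_eq0.
    by rewrite (setIidPr (subset_trans sC'C CB)).
  have /exitsP[x [y [/setIP[xB xC] yC]]] := strongP _ stC _ (subsetIr B C) BC0 BCC.
  rewrite inE yC andbT => yB xy; apply/exitsP; exists x, y.
  by split=> //; apply: (subsetP CR).
pose P (Q : {set D}) := (Q \subset R :\: N) && reaches Q C'.
have PC' : P C'.
  by rewrite /P C'Q reaches_refl.
(* The next [R] is a maximal part of [R :\: N] that contains [C'] and reaches it. *)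
have [R' /maxsetP[/andP[R'Q rR'] maxR'] C'R'] := maxset_exists PC'.
have R'R : R' \subset R := subset_trans R'Q (subsetDl _ _).
have wR' : w \notin R'.
  by apply/negP => /(subsetP R'Q); rewrite !inE wR zw (subsetP RA).
have DR : exits R (R :\: R').
  apply: (reachesP _ _ rRC'); rewrite ?subsetDl //.
    by apply/set0Pn; exists w; rewrite inE wR' wR.
  by rewrite -setI_eq0 setIDAC setD_eq0 (subset_trans (subsetIr _ _)).
have [a [b [/setDP[aR aR'] bR + ab]]] := exitsP _ _ DR.
rewrite inE bR andbT negbK => bR'.
(* Otherwise [a] could join [R'] through [b], against maximality. So [a] prolongs the path, and [b]
   continues it inside [R']. *)
have za : edge z a.
  apply: contraT => nza; case/negP: (aR'); rewrite -(maxR' (a |: R')) ?setU11 ?subsetUr //.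
  apply/andP; split.
    by rewrite subUset R'Q sub1set !inE aR (negbTE nza) andbF.
  apply/reachesP => B sB B0 BC'.
  have [bB|bB] := boolP (b \in B); last first.
    have [aB|aB] := boolP (a \in B).
      by apply/exitsP; exists a, b; rewrite inE bR' orbT.
    have BR' : B \subset R'.
      apply/subsetP => y yB; have := subsetP sB y yB.
      by rewrite !inE => /predU1P[Ey|//]; rewrite -Ey yB in aB.
    have /exitsP[x [y [xB yR' yB xy]]] := reachesP _ _ rR' B BR' B0 BC'.
    by apply/exitsP; exists x, y; rewrite inE yR' orbT.
  have BR'0 : B :&: R' != set0 by apply/set0Pn; exists b; rewrite inE bB.
  have BR'C : [disjoint B :&: R' & C'].
    by move: BC'; rewrite -!setI_eq0 setIAC => /eqP->; rewrite set0I.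
  have /exitsP[x [y [/setIP[xB _] yR' + xy]]] := reachesP _ _ rR' _ (subsetIr B R') BR'0 BR'C.
  rewrite inE yR' andbT => yB.
  by apply/exitsP; exists x, y; rewrite inE yR' orbT.
apply: (IH R' C' (rcons p z) a) => //.
- by rewrite size_rcons -szp addnS addSn.
- exact: (forward_dipath_rcons fs (sR a aR) (fun u up => noR u a up aR) za).
- by move=> u; rewrite mem_rcons inE => /predU1P[->|/sA//]; apply: (subsetP RA).
- exact: subset_trans R'R RA.
- move=> u uR'; rewrite mem_rcons inE negb_or sR ?(subsetP R'R) // andbT.
  by apply: contraNneq aR' => <-.
- move=> u y; rewrite mem_rcons inE => /predU1P[->|up] yR'; last first.
    by apply: noR up _; apply: (subsetP R'R).
  by have /setDP[yR] := subsetP R'Q y yR'; rewrite inE (subsetP RA).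
- by exists b.
by move=> y /(subsetP R'R)/noin; case: (p).
Qed.

End ForwardPaths.

(** * Passing to the converse digraph *)

Section Converse.
Variable D : digraph.

Definition converse : digraph :=
  @Digraph (vertex D) (fun u v => edge v u) (@edge_irrefl D)
    (fun u v => @edge_asym D v u).

Lemma acyclic_converse (A : {set D}) : @acyclic converse A -> acyclic A.
Proof.
move=> /acyclicP acA; apply/acyclicP => s sA; apply/negP => /and3P[s0 us cs].
have /negP[] : ~~ @dicycle converse (rev s).
  by apply: acA => x; rewrite mem_rev; apply: sA.
apply/and3P; split; rewrite ?rev_uniq ?rev_cycle //.
by rewrite -size_eq0 size_rev size_eq0.
Qed.

Lemma colorable_converse k (A : {set D}) : @colorable converse k A -> colorable k A.
Proof.
by move=> [f [fk acf]]; exists f; split=> // i; apply/acyclic_converse/acf.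
Qed.

Lemma strong_converse (A : {set D}) : strong A -> @strong converse A.
Proof.
move=> stA; apply/(@strongP converse) => B sB B0 BA.
have nB0 : A :\: B != set0.
  by apply: contra BA; rewrite setD_eq0 eqEsubset sB => ->.
have nBA : A :\: B != A.
  by apply: contra B0 => /eqP/setDidPl; rewrite disjoint_sym -setI_eq0 (setIidPl sB).
have /exitsP[x [y [/setDP[xA xB] yA + xy]]] := strongP _ stA _ (subsetDl A B) nB0 nBA.
rewrite inE yA andbT negbK => yB.
by apply/(@exitsP converse); exists y, x.
Qed.

Lemma closing_converse t : 0 < t -> closing D t -> closing converse t.
Proof.
move=> t0 clt x0 s szs [us fs].
have := clt x0 (rev s); rewrite size_rev szs !nth_rev ?szs ?ltn_predL //.
rewrite prednK // subnn subn1; apply=> //; split; first by rewrite rev_uniq.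
move=> y i j; rewrite size_rev => /andP[ij jt]; rewrite !nth_rev ?(ltn_trans ij jt) //.
have := fs y (size s - j.+1) (size s - i.+1); rewrite /= => ->; last by lia.
by apply/eqP/eqP; lia.
Qed.

End Converse.

(** * Induction on the clique bound *)

Section Main.
Variables (D : digraph) (t : nat).
Hypotheses (t3 : 2 < t) (clt : closing D t).
Implicit Types (A B C K : {set D}) (v : D).

Definition clique_bound w A := forall K, clique K -> K \subset A -> #|K| <= w.

(** With [c] the previous value, a vertex takes 1 color, its out- and in-neighbours [c] each, and
    all other vertices [t * c]; the total is at most [(t + 3) * c + 1]. *)
Fixpoint color_bound w := if w is w'.+1 then (t + 3) * color_bound w' + 1 else 0.

(** Adding [v] to a clique of its neighbours enlarges the clique by one. *)
Lemma clique_bound_neighbors w A B v : clique_bound w.+1 A -> v \in A -> B \subset A ->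
  {in B, forall u, edge u v || edge v u} -> clique_bound w B.
Proof.
move=> bA vA BA Bv K clK KB.
have vK : v \notin K.
  by apply/negP => /(subsetP KB)/Bv; rewrite edge_irrefl.
have := cardsU1 v K; rewrite vK add1n -ltnS => <-; apply: bA; last first.
  by rewrite subUset sub1set vA (subset_trans KB BA).
apply/forall_inP => x xK; apply/forall_inP => y yK; apply/implyP.
have {}KB z : z \in K -> edge z v || edge v z by move=> /(subsetP KB)/Bv.
case/setU1P: xK => [->|xK]; case/setU1P: yK => [->|yK]; rewrite ?eqxx //.
- by rewrite orbC KB.
- by rewrite KB.
by move: clK => /forall_inP/(_ x xK)/forall_inP/(_ y yK)/implyP.
Qed.

Lemma clique_bound_colorable w A : clique_bound w A -> colorable (color_bound w) A.
Proof.
elim: w A => [|w IH] A bA.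
  have [->|/set0Pn[v vA]] := eqVneq A set0; first exact: colorable0.
  suff cl1 : clique [set v] by have := bA _ cl1; rewrite cards1 sub1set vA => /(_ isT).
  by apply/forall_inP => x /set1P->; apply/forall_inP => y /set1P->; rewrite eqxx.
apply: strong_colorable => A' A'A stA'.
have {}bA : clique_bound w.+1 A' by move=> K clK KA'; apply: bA clK (subset_trans KA' A'A).
move: A' bA stA' {A A'A} => A bA stA /=.
have [->|/set0Pn[v vA]] := eqVneq A set0; first exact: colorable0.
set c := color_bound w in IH *.
have colN x B : x \in A -> B \subset A -> {in B, forall u, edge u x || edge x u} ->
    colorable c B.
  by move=> xA BA Bx; apply: IH (clique_bound_neighbors bA xA BA Bx).
have colO : {in A, forall x, colorable c [set u in A | edge x u]}.
  move=> x xA; apply: (colN x) => //; first by apply/subsetP => u /[!inE] /andP[].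
  by move=> u /[!inE] /andP[_ ->]; rewrite orbT.
have colI : {in A, forall x, colorable c [set u in A | edge u x]}.
  move=> x xA; apply: (colN x) => //; first by apply/subsetP => u /[!inE] /andP[].
  by move=> u /[!inE] /andP[_ ->].
pose N := [set u in A | edge v u] :|: [set u in A | edge u v].
have colB : colorable (t * c) (A :\: (v |: N)).
  apply: strong_colorable => C CB stC.
  have [->|C0] := eqVneq C set0; first exact: colorable0.
  have CA : C \subset A := subset_trans CB (subsetDl _ _).
  (* [N1] is [C] with its in-neighbours and misses [v]. An edge [xy] of [A] entering [N1] starts at
     distance 2 to [C]. *)
  pose N1 := C :|: [set y in A | [exists z in C, edge y z]].
  have N1A : A :\: N1 != A.
    have [z zC] := set0Pn _ C0.
    by apply/eqP => /setP/(_ z); rewrite !inE zC (subsetP CA).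
  have AN1 : A :\: N1 != set0.
    apply/set0Pn; exists v; rewrite !inE vA andbT negb_or.
    apply/andP; split; first by apply/negP => /(subsetP CB); rewrite !inE eqxx.
    apply/exists_inPn => z /(subsetP CB); rewrite !inE => /andP[+ zA].
    by rewrite zA /= !negb_or => /and3P[].
  have /exitsP[x [y [/setDP[xA xN1] yA yN1 xy]]] :=
    strongP _ stA _ (subsetDl A N1) AN1 N1A.
  have {}yN1 : y \in N1 by move: yN1; rewrite inE yA andbT negbK.
  have [xC nxC] : x \notin C /\ {in C, forall z, ~~ edge x z}.
    move: xN1; rewrite !inE xA /= negb_or => /andP[xC /exists_inPn nx].
    by split.
  have yC : y \notin C by apply: contraTN xy; apply: nxC.
  have [z zC yz] : exists2 z, z \in C & edge y z.
    by move: yN1; rewrite !inE (negbTE yC) yA /= => /exists_inP.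
  have rCC := reaches_refl C.
  have ct k : k <= t -> colorable (k * c) C -> colorable (t * c) C.
    by move=> kt; apply: colorableW; rewrite ?leq_mul2r ?kt ?orbT.
  have xy_neq : x != y by apply: contraTneq xy => ->; rewrite edge_irrefl.
  (* If [C] has an edge to [x], the path grows from [x] in the converse, where no vertex of [C]
     points to [x]. *)
  have [/exists_inP[u uC ux]|/exists_inPn nC] := boolP [exists u in C, edge u x].
    apply: (ct t.-2); first by rewrite (leq_trans (leq_pred _)) ?leq_pred.
    apply: colorable_converse.
    apply: (@no_in_neighbor_colorable (converse D) t c t.-2 A C C [::] x) => //.
    - exact: closing_converse (ltnW (ltnW t3)) clt.
    - by move=> a aA; apply: colorable_converse; apply: colI.
    - by rewrite add0n; case: (t) t3 => [|[]].
    - exact: forward_dipath1.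
    - by move=> a; rewrite inE => /eqP->.
    - by move=> a aC; rewrite inE; apply: contraNneq xC => <-.
    - exact: (@reaches_refl (converse D)).
    - exact: strong_converse.
    - by exists u.
  (* Otherwise no vertex of [C] points to [x] in [D], and the path grows from [x, y]. *)
  apply: (ct (t - 3)); first exact: leq_subr.
  apply: (@no_in_neighbor_colorable _ t c (t - 3) A C C [:: x] y) => //.
  - by rewrite /= add1n -[RHS](subnK t3) addn3.
  - apply: (@forward_dipath_rcons _ [::]) => //; first exact: forward_dipath1.
    by rewrite inE eq_sym.
  - by move=> a; rewrite !inE => /orP[]/eqP->.
  - by move=> a aC; rewrite !inE negb_or; apply/andP; split;
      [apply: contraNneq xC => <-|apply: contraNneq yC => <-].
  - by move=> a b; rewrite inE => /eqP->; apply: nxC.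
  - by exists z.
have -> : (t + 3) * c + 1 = 1 + (c + c) + t * c + c by clear; lia.
have -> : A = (v |: N) :|: (A :\: (v |: N)).
  apply/setP => u; rewrite !inE; case: eqP => [->|_] //=.
  by case: (u \in A); rewrite ?andbF ?andbT //= orbN.
apply: (@colorableW _ (1 + (c + c) + t * c)) => //; first exact: leq_addr.
apply: colorableU colB; apply: colorableU (colorable1 v) _.
by apply: colorableU; [apply: colO|apply: colI].
Qed.

End Main.

(** * Induced directed cycles from arbitrary ones *)

Section Shortest.
Variable D : digraph.
Implicit Types s : seq D.

Lemma dicycle_size s : dicycle s -> 2 < size s.
Proof.
case/and3P; case: s => [|x [|y [|z s]]] //= _ _; first by rewrite edge_irrefl.
by rewrite andbT; have /negP := edge_asym x y.
Qed.

Lemma dicycle_induced s : dicycle s -> exists s', @induced_dicycle D s'.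
Proof.
have [n] := ubnP (size s); elim: n s => // n IH s; rewrite ltnS => szn cs.
have [/'forall_in_forall_inP ind|] := boolP
  [forall u in s, forall v in s, edge u v ==> (v == next s u)].
  exists s; split=> // u v us vs uv.
  by have /implyP/(_ uv)/eqP := ind u us v vs.
case/forall_inPn => u us /forall_inPn[v vs]; rewrite negb_imply => /andP[uv nv].
have [s0 uniqs cyc] := and3P cs; have [i p Es] := rot_to us.
have up : uniq (u :: p) by rewrite -Es rot_uniq.
have cp : path edge u (rcons p u) by move: cyc; rewrite -(rot_cycle i) Es.
have: v \in u :: p by rewrite -Es mem_rot.
rewrite inE => /predU1P[Ev|vp]; first by rewrite Ev edge_irrefl in uv.
have nv' : v != next (u :: p) u by rewrite -Es next_rot.
(* As [v] is not next after [u], some [y] lies between them, and the chord [uv] cuts it off. *)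
case/splitPr: vp nv' up cp Es => [[|y p1] p2]; first by rewrite /= eqxx eqxx.
move=> _ up cp Es; apply: (IH (u :: v :: p2)).
  by apply: leq_trans szn; rewrite -(size_rot i s) Es /= size_cat /=; lia.
apply/and3P; split=> //.
  by apply: subseq_uniq up; have /= := suffix_subseq (y :: p1) (v :: p2); rewrite eqxx.
rewrite /= uv /=; move: cp; rewrite rcons_cat cat_path => /andP[_] /=.
by case/andP.
Qed.

End Shortest.

(** * The bound on the dichromatic number *)

Lemma dichromatic_number_le (D : digraph) k :
  colorable k [set: D] -> dichromatic_number D <= k.+1.
Proof.
move=> [f [fk acf]]; rewrite /dichromatic_number; case: ex_minnP => m _; apply.
(* The extra color keeps ['I_k.+1] inhabited for [inord], even if [k = 0]. *)
apply/existsP; exists [ffun v => inord (f v)]; apply/forallP => i.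
apply: acyclic_sub (acf i); apply/subsetP => v; rewrite !inE ffunE => /eqP <-.
rewrite inordK ?eqxx //; exact: ltnW (fk v (in_setT v)).
Qed.

Theorem theorem1p2 :
  forall t : int, exists f : nat -> nat,
    forall D : digraph, chordal D t -> induced_dipath_free D t ->
      dichromatic_number D <= f (clique_number D).
Proof.
(* One unit comes from [dichromatic_number_le]; the other makes the value at least 2, as the acyclic
   case [t <= 2] requires. *)
move=> t; exists (fun w => (color_bound `|t|%N w).+2) => D chD pfD.
have [t3|t3] := boolP (3 <= t)%R.
  case: t t3 chD pfD => // n; rewrite lez_nat => n3 chD pfD /=.
  apply/(leq_trans _ (leqnSn _))/dichromatic_number_le/clique_bound_colorable => //.
    exact: chordal_closing (ltnW (ltnW n3)) chD pfD.
  by move=> K clK _; rewrite /clique_number leq_bigmax_cond.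
apply: (@leq_trans 2) => //; apply: dichromatic_number_le.
exists (fun=> 0); split=> // i; apply/acyclicP => s _; apply: contra t3.
by move=> /dicycle_induced[s' is']; rewrite -(chD _ is') lez_nat dicycle_size; case: is'.
Qed.
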